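(* Let $(f_n)_{n\in\mathbb N}$ be a Boolean function family. Then there exists a projective Boolean function family $(g_n)_{n\in\mathbb N}$ such that $(f_n)$ is non-uniform linear-length $\mathcal{IS}_{br}$-reducible to $(g_n)$.
   Context: Let $\mathbb B=\{\mathsf T,\mathsf F\}$. There are Boolean registers named $\mathtt{in}{:}i$, $\mathtt{aux}{:}i$ ($i\ge1$) and $\mathtt{out}$, processing methods $\mathtt{set{:}T}$ (content becomes $\mathsf T$, reply $\mathsf T$), $\mathtt{set{:}F}$ (content becomes $\mathsf F$, reply $\mathsf F$), $\mathtt{get}$ (no change, reply is the content). Basic instructions are $f.m$. Primitive instructions: for each basic instruction $a$, the plain instruction $a$, positive test $+a$, negative test $-a$; forward jumps $\#l$ ($l\in\mathbb N$); termination $!$. An instruction sequence is a finite non-empty sequence $X=u_1;\dots;u_k$ of primitive instructions, $|X|=k$. Execution starts at $u_1$: $a$ executes $a$ and proceeds with the next instruction; $+a$ executes $a$ and proceeds with the next instruction if the reply is $\mathsf T$, otherwise skips the next instruction and proceeds with the one after; $-a$ likewise with reply roles reversed; $\#l$ proceeds with the $l$-th next instruction ($\#0$ causes inaction); $!$ terminates; if there is no instruction to proceed with, inaction occurs. $\mathcal{IS}_{br}$ is the set of instruction sequences whose basic instructions are all of the forms $\mathtt{in}{:}i.\mathtt{get}$, $\mathtt{aux}{:}i.\mathtt{get}$, $\mathtt{aux}{:}i.\mathtt{set{:}}b$, $\mathtt{out}.\mathtt{set{:}}b$. $X$ computes $f:\mathbb B^n\to\mathbb B$ if for all $b_1,\dots,b_n$,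 executing $X$ with $\mathtt{in}{:}i$ initially $b_i$ ($i\le n$) and all auxiliary registers and $\mathtt{out}$ initially $\mathsf F$, execution never executes an instruction on $\mathtt{in}{:}i$ with $i>n$, ends by executing $!$, and leaves $f(b_1,\dots,b_n)$ in $\mathtt{out}$. A Boolean function family is a sequence $(f_n)_{n\in\mathbb N}$ with $f_n:\mathbb B^n\to\mathbb B$. It is projective if $f_n(b_1,\dots,b_n)=f_{n+1}(b_1,\dots,b_n,\mathsf F)$ for all $n$ and $b_1,\dots,b_n\in\mathbb B$. For $l,m,n\in\mathbb N$, $f:\mathbb B^n\to\mathbb B$ and $g:\mathbb B^m\to\mathbb B$, $f\le_l g$ if there exist $h_1,\dots,h_m:\mathbb B^n\to\mathbb B$ computed by $X_1,\dots,X_m\in\mathcal{IS}_{br}$ with $|X_j|\le l$ such that $f(b)=g(h_1(b),\dots,h_m(b))$ for all $b\in\mathbb B^n$. $(f_n)$ is non-uniform linear-length $\mathcal{IS}_{br}$-reducible to $(g_n)$ if there is a linear function $h:\mathbb N\to\mathbb N$ such that for every $n$ there exist $l,m\le h(n)$ with $f_n\le_l g_m$. *)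

(* Defs.v *)
From HB Require Import structures.
From mathcomp Require Import all_boot.

Set Implicit Arguments.
Unset Strict Implicit.
Unset Printing Implicit Defensive.

(* Registers in:i, aux:i and out.  Indices start at 1; index 0 is ruled out by
   [br_basic] below. *)
Inductive register := In of nat | Aux of nat | Out.

Definition register_eq_dec (r r' : register) : decidable (r = r').
Proof. by rewrite /decidable; decide equality; apply: eq_comparable. Defined.

HB.instance Definition _ := hasDecEq.Build register (compareP register_eq_dec).

Inductive method := SetTo of bool | Get.

Record basic_instr := Basic { focus : register; meth : method }.

Inductive instr :=
  | Plain of basic_instr
  | PosTest of basic_instr
  | NegTest of basic_instr
  | Jump of nat
  | Term.

Definition content_after (m : method) (c : bool) : bool :=
  match m with SetTo b => b | Get => c end.

Definition reply_of (m : method) (c : bool) : bool :=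
  match m with SetTo b => b | Get => c end.

Definition state := register -> bool.

Definition apply_basic (a : basic_instr) (s : state) : state :=
  fun r => if r == focus a then content_after (meth a) (s r) else s r.

Definition reply (a : basic_instr) (s : state) : bool :=
  reply_of (meth a) (s (focus a)).

Definition accessible (n : nat) (a : basic_instr) : bool :=
  if focus a is In i then i <= n else true.

(* [exec n X s s']: starting at the head of X in state s, execution ends by
   executing Term in state s', and no instruction on in:i with i > n is ever
   executed.  Since all control flow is forward, the current position is
   represented by the remaining suffix.  Inaction (no instruction to proceed
   with, or Jump 0) is the absence of a rule. *)
Inductive exec (n : nat) : seq instr -> state -> state -> Prop :=
  | ExecTerm X s :
      exec n (Term :: X) s s
  | ExecJump l X s s' :
      exec n (drop l X) s s' ->
      exec n (Jump l.+1 :: X) s s'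
  | ExecPlain a X s s' :
      accessible n a -> exec n X (apply_basic a s) s' ->
      exec n (Plain a :: X) s s'
  | ExecPos a X s s' :
      accessible n a ->
      exec n (if reply a s then X else drop 1 X) (apply_basic a s) s' ->
      exec n (PosTest a :: X) s s'
  | ExecNeg a X s s' :
      accessible n a ->
      exec n (if reply a s then drop 1 X else X) (apply_basic a s) s' ->
      exec n (NegTest a :: X) s s'.

Definition br_basic (a : basic_instr) : bool :=
  match focus a, meth a with
  | In i, Get => 0 < i
  | Aux i, Get => 0 < i
  | Aux i, SetTo _ => 0 < i
  | Out, SetTo _ => true
  | _, _ => false
  end.

Definition br_instr (u : instr) : bool :=
  match u with
  | Plain a | PosTest a | NegTest a => br_basic a
  | Jump _ | Term => true
  end.

Definition IS_br (X : seq instr) : bool := (0 < size X) && all br_instr X.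

(* The head [false] shifts b to 1-based indexing; the values given to in:i for
   i = 0 and i > n are never used. *)
Definition init_state (n : nat) (b : n.-tuple bool) : state :=
  fun r => if r is In i then nth false (false :: b) i else false.

Definition computes (n : nat) (X : seq instr) (f : n.-tuple bool -> bool) : Prop :=
  forall b : n.-tuple bool,
    exists2 s : state, exec n X (init_state b) s & s Out = f b.

Definition bool_family := forall n : nat, n.-tuple bool -> bool.

Definition projective (f : bool_family) : Prop :=
  forall (n : nat) (b : n.-tuple bool), f n b = f n.+1 [tuple of rcons b false].

Definition length_reducible (l n m : nat)
    (f : n.-tuple bool -> bool) (g : m.-tuple bool -> bool) : Prop :=
  exists h : 'I_m -> n.-tuple bool -> bool,
    (forall j : 'I_m,
       exists X : seq instr, [/\ IS_br X, size X <= l & computes X (h j)]) /\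
    (forall b : n.-tuple bool, f b = g [tuple h j b | j < m]).

(* Linear in the sense of complexity bounds: a constant term is allowed. *)
Definition linear_function (h : nat -> nat) : Prop :=
  exists a c : nat, forall n : nat, h n = a * n + c.

Definition linear_length_reducible (f g : bool_family) : Prop :=
  exists2 h : nat -> nat, linear_function h &
    forall n : nat, exists l m : nat,
      [/\ l <= h n, m <= h n & length_reducible l (f n) (g m)].

(* Main.v *)
(* Let [g_m] ignore its input from the last [true] on: if that [true] is the
   [k.+1]-th input bit, the value is [f_k] of the first [k] bits.  Trailing
   [false] bits do not matter, so [g] is projective, and [f_n b] is
   [g_(n+1)] at [b] followed by [true]; each bit of that argument is computed
   by at most three instructions. *)
Require Import Defs.
From mathcomp Require Import all_boot.

(** Reading the arity off the list lets [eval_below_mark] recurse on plain lists, with no casts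
    between tuple types. *)
Definition eval_seq (f : bool_family) (s : seq bool) : bool :=
  f (size s) (in_tuple s).

(* The bits are listed last to first. *)
Fixpoint eval_below_mark (f : bool_family) (r : seq bool) : bool :=
  match r with
  | [::] => false
  | true :: r' => eval_seq f (rev r')
  | false :: r' => eval_below_mark f r'
  end.

Definition marked_family (f : bool_family) : bool_family :=
  fun n b => eval_below_mark f (rev b).

Lemma eval_seq_tuple (f : bool_family) (n : nat) (b : n.-tuple bool) :
  eval_seq f b = f n b.
Proof.
case: b => s sz_s; have sz_n := eqP sz_s.
(* Eliminating [sz_n] turns [n] into [size s]; the two tuples then differ only in their size
   proofs. *)
by case: _ / sz_n sz_s => sz_s; congr (f _ _); apply: val_inj.
Qed.

Lemma marked_family_projective (f : bool_family) :
  projective (marked_family f).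
Proof. by move=> n b; rewrite /marked_family /= rev_rcons. Qed.

Lemma marked_family_rcons_true (f : bool_family) (n : nat) (b : n.-tuple bool) :
  marked_family f n.+1 [tuple of rcons b true] = f n b.
Proof. by rewrite /marked_family /= rev_rcons /= revK eval_seq_tuple. Qed.

Definition set_out_true : instr := Plain (Basic Out (SetTo true)).

Lemma computes_true (n : nat) :
  computes [:: set_out_true; Term] (fun _ : n.-tuple bool => true).
Proof.
move=> b; exists (apply_basic (Basic Out (SetTo true)) (init_state b)) => //.
by apply: ExecPlain => //; apply: ExecTerm.
Qed.

(** [Out] starts as [false], so only a reply [true] calls for a write; on [false] the test skips to
    [Term]. *)
Lemma computes_nth (n j : nat) : j < n ->
  computes [:: PosTest (Basic (In j.+1) Get); set_out_true; Term]
    (fun b : n.-tuple bool => nth false b j).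
Proof.
move=> lt_jn b; set a := Basic _ Get; set s := apply_basic a (init_state b).
exists (if nth false b j then apply_basic (Basic Out (SetTo true)) s else s).
  apply: ExecPos => //; rewrite /reply /=.
  case: (nth false b j); last exact: ExecTerm.
  by apply: ExecPlain => //; apply: ExecTerm.
by case: (nth false b j).
Qed.

Lemma length_reducible_marked_family (f : bool_family) (n : nat) :
  length_reducible 3 (f n) (marked_family f n.+1).
Proof.
exists (fun j b => nth false (rcons b true) j); split=> [j | b].
  have [lt_jn | le_nj] := ltnP j n.
    exists [:: PosTest (Basic (In j.+1) Get); set_out_true; Term].
    split=> // b; have [s Xs outs] := computes_nth n j lt_jn b.
    by exists s; rewrite ?outs // nth_rcons size_tuple lt_jn.
  (* The only remaining index is that of the appended mark. *)
  have j_eq_n : j = n :> nat by apply/eqP; rewrite eqn_leq le_nj -ltnS ltn_ord.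
  exists [:: set_out_true; Term].
  split=> // b; have [s Xs outs] := computes_true n b.
  by exists s; rewrite ?outs // nth_rcons size_tuple j_eq_n ltnn eqxx.
rewrite -marked_family_rcons_true; congr marked_family.
by apply: eq_from_tnth => j; rewrite tnth_mktuple (tnth_nth false).
Qed.

Theorem theorem15 (f : bool_family) :
  exists g : bool_family, projective g /\ linear_length_reducible f g.
Proof.
exists (marked_family f); split; first exact: marked_family_projective.
(* [n + 3] bounds both the length 3 and the arity [n.+1]. *)
exists (fun n => n + 3) => [|n].
  by exists 1, 3 => n; rewrite mul1n.
exists 3, n.+1; split; first exact: leq_addl.
  by rewrite addnS ltnS leq_addr.
exact: length_reducible_marked_family.
Qed.
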